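(* For integers $m,k\ge 1$ let \[a(m, k) = |\mathrm{ParseWords}(\mathrm{LeftTurnTree}(m, k+1), \mathrm{RightTurnTree}(k, m+1))|.\] Then for all integers $m \geq 1$ and $k \geq 1$, \[a(m+3, k) - 2\, a(m+2, k) - a(m+1, k) + 2\, a(m, k) = 0.\]
   Context: A binary tree is a rooted ordered tree in which each vertex has either $0$ or $2$ children; its leaves are ordered left to right. Let $G$ be the context-free grammar with start symbols $0,1,2$ and rules $0\to 12$, $0\to 21$, $1\to 02$, $1\to 20$, $2\to 01$, $2\to 10$. An $n$-leaf binary tree $T$ parses a word $w$ of length $n$ on $\{0,1,2\}$ if there is a labeling of the vertices of $T$ by $0,1,2$ such that the leaves, from left to right, are labeled with the letters of $w$, and at every internal vertex the label of the vertex together with the labels of its left and right children form a rule of $G$ (i.e. the three labels are pairwise distinct). If $T$ parses $w$, it also parses every word obtained from $w$ by permuting the alphabet $\{0,1,2\}$. For binary trees $T_1,T_2$ with the same number of leaves, $\mathrm{ParseWords}(T_1,T_2)$ denotes the set of equivalence classes (under permutations of the alphabet $\{0,1,2\}$) of words parsed by both $T_1$ and $T_2$. The level of a vertex is its distance from the root. A path tree is a binary tree with at most two vertices on each level. For $N\ge 2$, $N$-leaf path trees correspond bijectively to words $x_1\cdots x_{N-2}$ on $\{l,r\}$: $x_j=l$ (resp. $x_j=r$) means that, of the two vertices on level $j$, the left (resp. right) one has children. $\mathrm{LeftTurnTree}(p,q)$ is the $(p+q)$-leaf path tree corresponding to $l^p r^{q-2}$, and $\mathrm{RightTurnTree}(p,q)$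 is the $(p+q)$-leaf path tree corresponding to $r^p l^{q-2}$. *)

(* Defs.v *)
From mathcomp Require Import all_boot all_fingroup.
From mathcomp Require Import boolp.

Set Implicit Arguments.
Unset Strict Implicit.
Unset Printing Implicit Defensive.

Inductive btree : Type := Leaf | Node of btree & btree.

Fixpoint nleaves (T : btree) : nat :=
  if T is Node l r then nleaves l + nleaves r else 1.

Notation letter := 'I_3.

(* A binary tree together with a labeling of all its vertices. *)
Inductive ltree : Type := LLeaf of letter | LNode of letter & ltree & ltree.

Fixpoint shape_of (L : ltree) : btree :=
  if L is LNode _ l r then Node (shape_of l) (shape_of r) else Leaf.

Definition label (L : ltree) : letter :=
  match L with LLeaf a => a | LNode a _ _ => a end.

Fixpoint leaf_word (L : ltree) : seq letter :=
  match L with LLeaf a => [:: a] | LNode _ l r => leaf_word l ++ leaf_word r end.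

(* a -> bc is one of the six rules 0 -> 12, 0 -> 21, 1 -> 02, 1 -> 20,
   2 -> 01, 2 -> 10 exactly when a, b, c are pairwise distinct. *)
Definition rule (a b c : letter) : bool := uniq [:: a; b; c].

Fixpoint obeys_rules (L : ltree) : bool :=
  if L is LNode a l r then
    [&& rule a (label l) (label r), obeys_rules l & obeys_rules r]
  else true.

(* The label of the root is unconstrained: all three letters are start
   symbols. *)
Definition parses (T : btree) (w : seq letter) : Prop :=
  exists L : ltree, [/\ shape_of L = T, leaf_word L = w & obeys_rules L].

Definition perm_equiv n : rel (n.-tuple letter) :=
  [rel w v | [exists s : 'S_3, v == map_tuple s w]].

(* Only meaningful when nleaves T1 = nleaves T2.  The words parsed by both
   trees are closed under perm_equiv, so the blocks are full classes. *)
Definition ParseWords (T1 T2 : btree) :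
    {set {set (nleaves T1).-tuple letter}} :=
  equivalence_partition (@perm_equiv (nleaves T1))
    [set w : (nleaves T1).-tuple letter |
      `[< parses T1 w >] && `[< parses T2 w >]].

Inductive side : Type := SideL | SideR.

(* The path tree of x_1 ... x_(N-2): x_1 tells which child of the root has
   children, and the remaining letters describe the subtree at that child. *)
Fixpoint path_tree (x : seq side) : btree :=
  match x with
  | [::] => Node Leaf Leaf
  | SideL :: x' => Node (path_tree x') Leaf
  | SideR :: x' => Node Leaf (path_tree x')
  end.

(* Intended for q >= 2, since the subtraction is truncated. *)
Definition LeftTurnTree (p q : nat) : btree :=
  path_tree (nseq p SideL ++ nseq (q - 2) SideR).

Definition RightTurnTree (p q : nat) : btree :=
  path_tree (nseq p SideR ++ nseq (q - 2) SideL).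

Definition a (m k : nat) : nat :=
  #|ParseWords (LeftTurnTree m (k + 1)) (RightTurnTree k (m + 1))|.

(* Main.v *)
(* Two distinct children labels determine the label of their parent, so going
   up a comb whose leaves carry v is a partial walk [walk p v] on the triangle
   K3, defined as long as no letter equals the current state.  For a word
   rev u ++ c :: v with |u| = k and |v| = m, the left-turn tree walks from c
   along u and then along v, and the right-turn tree along v and then along u.
   For fixed u and c, reading v moves a pair of states, and the number of good
   v of length m is annihilated by (X - 2)(X - 1)(X + 1).  Finally S_3 acts
   freely on the parsed words, so 6 a(m, k) is the sum of these numbers. *)
Require Import Defs.
From mathcomp Require Import all_boot all_fingroup all_algebra.
From mathcomp Require Import boolp zify.

Import GRing.Theory.
Local Open Scope ring_scope.

(** * Arithmetic of the rules in Z/3 *)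

Definition third (b c : letter) : letter := - (b + c).

(** Letters are residues modulo 3 and 0 + 1 + 2 = 0, so once two letters differ, minus their sum is
    the remaining one. *)
Lemma ruleE (a b c : letter) : rule a b c = (c != b) && (a == third b c).
Proof.
by case: a => [[|[|[|a]]] ?] //; case: b => [[|[|[|b]]] ?] //;
   case: c => [[|[|[|c]]] ?].
Qed.

Lemma rule_swap (a b c : letter) : rule a b c = rule a c b.
Proof. by apply: perm_uniq; rewrite perm_cons (perm_catC [:: b] [:: c]). Qed.

(** * Parsing by path trees as walks *)

Fixpoint walk (p : letter) (v : seq letter) : option letter :=
  if v is x :: v' then if x == p then None else walk (third p x) v' else Some p.

(** The root label is kept because it is the state from which the walk continues one level up. *)
Definition parses_as (T : btree) (w : seq letter) (a : letter) : Prop :=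
  exists L : ltree,
    [/\ shape_of L = T, leaf_word L = w, obeys_rules L & label L = a].

Lemma parsesE T w : parses T w <-> exists a, parses_as T w a.
Proof.
split=> [[L [sL wL rL]]|[a [L [sL wL rL _]]]]; last by exists L.
by exists (label L), L.
Qed.

Lemma parses_as_Leaf c a : parses_as Leaf [:: c] a <-> a = c.
Proof.
split=> [[[b|b L1 L2] [] //= _ [->] _ ->] //|->].
by exists (LLeaf c).
Qed.

Lemma parses_as_nodeL T u x a : parses_as (Node T Leaf) (rcons u x) a <->
  exists2 b, parses_as T u b & rule a b x.
Proof.
split=> [[[b|b L1 [c|c L2 L3]] [] //= [sL]]|[b [L [sL wL rL lL]] r]].
  rewrite cats1 => /rcons_inj [<- <-] /and3P[r r1 _] <-.
  by exists (label L1) => //; exists L1.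
exists (LNode a L (LLeaf x)); split=> //=; first by rewrite sL.
  by rewrite wL cats1.
by rewrite lL r rL.
Qed.

Lemma parses_as_nodeR T u x a : parses_as (Node Leaf T) (x :: u) a <->
  exists2 b, parses_as T u b & rule a b x.
Proof.
split=> [[[b|b [c|c L2 L3] L1] [] //= [sL]]|[b [L [sL wL rL lL]] r]].
  move=> [<- <-] /andP[r r1] <-.
  by exists (label L1); [exists L1 | rewrite rule_swap].
exists (LNode a (LLeaf x) L); split=> //=; first by rewrite sL.
  by rewrite wL.
by rewrite lL rule_swap r rL.
Qed.

Lemma walk_cons p x v a :
  walk p (x :: v) = Some a <-> exists2 b, rule b p x & walk b v = Some a.
Proof.
rewrite /=; split=> [|[b]]; last by rewrite ruleE => /andP[/negPf-> /eqP->].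
by case: eqP => // /eqP xp wv; exists (third p x) => //; rewrite ruleE xp /=.
Qed.

Lemma parses_as_iterL T u v a :
  parses_as (iter (size v) (Node^~ Leaf) T) (u ++ v) a <->
  exists2 b, parses_as T u b & walk b v = Some a.
Proof.
elim: v T u => [|x v IH] T u.
  by rewrite cats0; split=> [Ta|[b Tb [<-]] //]; exists a.
rewrite [size _]/= iterSr -cat_rcons IH; split=> [[b /parses_as_nodeL[c Tc r] wv]|].
  by exists c => //; apply/walk_cons; exists b.
move=> [c Tc /walk_cons[b r wv]]; exists b => //.
by apply/parses_as_nodeL; exists c.
Qed.

(** The walk climbs from the innermost leaf outwards. Left leaves are then met from right to left,
    hence [rev v]. *)
Lemma parses_as_iterR T u v a :
  parses_as (iter (size v) (Node Leaf) T) (rev v ++ u) a <->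
  exists2 b, parses_as T u b & walk b v = Some a.
Proof.
elim: v T u => [|x v IH] T u.
  by split=> [Ta|[b Tb [<-]] //]; exists a.
rewrite [size _]/= iterSr rev_cons cat_rcons IH.
split=> [[b /parses_as_nodeR[c Tc r] wv]|].
  by exists c => //; apply/walk_cons; exists b.
move=> [c Tc /walk_cons[b r wv]]; exists b => //.
by apply/parses_as_nodeR; exists c.
Qed.

Lemma path_tree_nseqL m x :
  path_tree (nseq m SideL ++ x) = iter m (Node^~ Leaf) (path_tree x).
Proof. by elim: m => //= m ->. Qed.

Lemma path_tree_nseqR m x :
  path_tree (nseq m SideR ++ x) = iter m (Node Leaf) (path_tree x).
Proof. by elim: m => //= m ->. Qed.

(** The bottom [Node Leaf Leaf] of a path tree counts as one more turn over a single [Leaf], in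
    either direction. This leaf carries the starting letter c. *)
Lemma LeftTurnTreeE m k : LeftTurnTree m (k.+1 + 1) =
  iter m (Node^~ Leaf) (iter k.+1 (Node Leaf) Leaf).
Proof.
rewrite /LeftTurnTree path_tree_nseqL addn1 subSS subSS subn0 -[nseq k _]cats0.
by rewrite path_tree_nseqR -iterSr.
Qed.

Lemma RightTurnTreeE m k : RightTurnTree k (m.+1 + 1) =
  iter k (Node Leaf) (iter m.+1 (Node^~ Leaf) Leaf).
Proof.
rewrite /RightTurnTree path_tree_nseqR addn1 subSS subSS subn0 -[nseq m _]cats0.
by rewrite path_tree_nseqL -iterSr.
Qed.

Definition walk2 (c : letter) (u v : seq letter) : bool :=
  isSome (obind (walk^~ v) (walk c u)).

Lemma walk2P c u v : reflect
  (exists a b, walk c u = Some b /\ walk b v = Some a) (walk2 c u v).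
Proof.
rewrite /walk2; apply: (iffP idP) => [|[a [b [-> /= -> //]]]].
case E: (walk c u) => [b|//] /=; case Eb: (walk b v) => [a|//] _.
by exists a, b.
Qed.

Lemma parses_LeftTurnTree u c v : (0 < size u)%N ->
  parses (LeftTurnTree (size v) (size u + 1)) (rev u ++ c :: v) <-> walk2 c u v.
Proof.
case E: (size u) => [//|k] _.
rewrite LeftTurnTreeE parsesE -E -cat_rcons -cats1; split.
  move=> [a /parses_as_iterL[b /parses_as_iterR[d /parses_as_Leaf-> wu] wv]].
  by apply/walk2P; exists a, b.
move=> /walk2P[a [b [wu wv]]]; exists a; apply/parses_as_iterL; exists b => //.
by apply/parses_as_iterR; exists c => //; apply/parses_as_Leaf.
Qed.

Lemma parses_RightTurnTree u c v : (0 < size v)%N ->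
  parses (RightTurnTree (size u) (size v + 1)) (rev u ++ c :: v) <-> walk2 c v u.
Proof.
case E: (size v) => [//|k] _.
rewrite RightTurnTreeE parsesE -E -cat1s; split.
  move=> [a /parses_as_iterR[b /parses_as_iterL[d /parses_as_Leaf-> wu] wv]].
  by apply/walk2P; exists a, b.
move=> /walk2P[a [b [wu wv]]]; exists a; apply/parses_as_iterR; exists b => //.
by apply/parses_as_iterL; exists c => //; apply/parses_as_Leaf.
Qed.

(** * The free action of S_3 on parsed words *)

Fixpoint relabel (s : letter -> letter) (L : ltree) : ltree :=
  match L with
  | LLeaf a => LLeaf (s a)
  | LNode a l r => LNode (s a) (relabel s l) (relabel s r)
  end.

Lemma parses_map (s : letter -> letter) T w : injective s ->
  parses T w -> parses T [seq s x | x <- w].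
Proof.
move=> s_inj [L [<- <- rL]]; exists (relabel s L).
elim: L rL => //= a l IHl r IHr /and3P[rl /IHl[-> -> ->] /IHr[-> -> ->]].
split=> //; first by rewrite map_cat.
have label_relabel L : label (relabel s L) = s (label L) by case: L.
by rewrite !label_relabel !andbT /rule -[[:: _; _; _]]/(map s [:: _; _; _]) map_inj_uniq.
Qed.

(** A permutation of three letters is determined by its values at two distinct ones. *)
Lemma map_perm_inj (w : seq letter) x y : x \in w -> y \in w -> x != y ->
  injective (fun s : 'S_3 => [seq s i | i <- w]).
Proof.
move=> xw yw xy s t /eq_in_map st; apply/permP => z.
have [sx sy] : s x = t x /\ s y = t y by split; apply: st.
have [->//|zx] := eqVneq z x; have [->//|zy] := eqVneq z y.
have third_uniq (a b c : letter) : c != a -> c != b -> a != b -> c = third a b.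
  move=> ca cb ab; apply/eqP.
  suff : rule c a b by rewrite ruleE => /andP[].
  by rewrite /rule /= !inE negb_or ca cb ab.
rewrite (third_uniq (s x) (s y) (s z)) ?(inj_eq perm_inj) //.
by rewrite (third_uniq (t x) (t y) (t z)) ?(inj_eq perm_inj) // sx sy.
Qed.

Lemma perm_equiv_equiv n : equivalence_rel (@perm_equiv n).
Proof.
move=> w v z; split.
  apply/existsP; exists 1%g; apply/eqP/val_inj => /=.
  by rewrite (eq_map (@perm1 _)) map_id.
move=> /existsP[s /eqP->]; apply/existsP/existsP => -[t /eqP ->].
  exists (s^-1 * t)%g; apply/eqP/val_inj => /=.
  by rewrite -map_comp; apply: eq_map => i /=; rewrite permM permK.
exists (s * t)%g; apply/eqP/val_inj => /=.
by rewrite -map_comp; apply: eq_map => i /=; rewrite permM.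
Qed.

(** Each block is an S_3-orbit with trivial stabilizers, so it has 3! = 6 elements. *)
Lemma card_perm_classes n (D : {set n.-tuple letter}) :
  (forall (s : 'S_3) w, w \in D -> map_tuple s w \in D) ->
  (forall w : n.-tuple letter, w \in D ->
     exists x y, [/\ x \in w, y \in w & x != y]) ->
  #|D| = (#|equivalence_partition (@perm_equiv n) D| * 6)%N.
Proof.
move=> Dclosed Dfree; apply: card_uniform_partition; last first.
  by apply: equivalence_partitionP => w v z _ _ _; apply: perm_equiv_equiv.
move=> B /imsetP[w wD ->].
have [x [y [xw yw xy]]] := Dfree w wD.
have -> : [set v in D | perm_equiv w v] = [set map_tuple s w | s : 'S_3].
  apply/setP => v; rewrite inE; apply/andP/imsetP.
    by move=> [_ /existsP[s /eqP->]]; exists s.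
  move=> [s _ ->]; split; first exact: Dclosed.
  by apply/existsP; exists s.
rewrite card_imset; first by rewrite card_Sn.
by move=> s t /(congr1 val) /(map_perm_inj _ _ _ xw yw xy).
Qed.

(** * Counting words letter by letter *)

Lemma sum_tupleS n (F : seq letter -> nat) :
  (\sum_(w : n.+1.-tuple letter) F w =
   \sum_(x : letter) \sum_(v : n.-tuple letter) F (x :: v))%N.
Proof.
rewrite pair_big /= (reindex (fun p : letter * n.-tuple letter => [tuple of p.1 :: p.2])) //=.
exists (fun w => (thead w, [tuple of behead w])) => [[x v] _|w _] /=.
  by congr pair; apply/val_inj.
by rewrite [RHS]tuple_eta.
Qed.

Lemma sum_tuple_cat p n (F : seq letter -> nat) :
  (\sum_(w : (p + n).-tuple letter) F w =
   \sum_(u : p.-tuple letter) \sum_(v : n.-tuple letter) F (u ++ v))%N.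
Proof.
elim: p F => [|p IH] F.
  rewrite (bigD1 [tuple]) //= [X in _ = (_ + X)%N]big1 ?addn0 // => u.
  by move=> /eqP[]; apply: val_inj; case: u => -[].
rewrite (sum_tupleS p (fun u => \sum_(v : n.-tuple letter) F (u ++ v)))%N.
rewrite sum_tupleS; apply: eq_bigr => x _.
by rewrite (IH (fun w => F (x :: w))).
Qed.

Definition cnt (n : nat) (P : pred (seq letter)) : nat :=
  \sum_(w : n.-tuple letter) P w.

Lemma cntS n P : cnt n.+1 P = (\sum_(x : letter) cnt n (fun v => P (x :: v)))%N.
Proof. exact: (sum_tupleS _ (fun w => nat_of_bool (P w))). Qed.

Lemma cnt_cat p n P :
  cnt (p + n) P = (\sum_(u : p.-tuple letter) cnt n (fun v => P (u ++ v)))%N.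
Proof. exact: (sum_tuple_cat _ _ (fun w => nat_of_bool (P w))). Qed.

Lemma eq_cnt n P Q : {in [pred w | size w == n], P =1 Q} -> cnt n P = cnt n Q.
Proof. by move=> PQ; apply: eq_bigr => w _; rewrite PQ // inE size_tuple. Qed.

Lemma card_cnt n (P : pred (seq letter)) :
  #|[set w : n.-tuple letter | P w]| = cnt n P.
Proof. by rewrite -sum1dep_card big_mkcond; apply: eq_bigr => w _; case: (P w). Qed.

(** * The recurrence of (X - 2)(X - 1)(X + 1) for pairs of walks *)

Definition rec3 (f : nat -> nat) : Prop := forall m,
  (f m.+3 + 2 * f m = 2 * f m.+2 + f m.+1)%N.

Lemma rec3_sum (I : finType) (f : I -> nat -> nat) :
  (forall i, rec3 (f i)) -> rec3 (fun m => \sum_i f i m)%N.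
Proof.
move=> frec m; rewrite !big_distrr /= -!big_split /=.
by apply: eq_bigr => i _; apply: frec.
Qed.

(** Both walks read the same v. The first only has to survive; [E] will say that the second can go
    on along u. *)
Definition joint_walk (E : pred letter) (p q : letter) (v : seq letter) : bool :=
  isSome (walk p v) && (if walk q v is Some d then E d else false).

Lemma joint_walk_cons E p q x v : joint_walk E p q (x :: v) =
  [&& x != p, x != q & joint_walk E (third p x) (third q x) v].
Proof. by rewrite /joint_walk /=; do 2!case: eqP => //=; rewrite andbF. Qed.

Lemma cnt_joint_walkS E p q m : cnt m.+1 (joint_walk E p q) =
  (\sum_(x | (x != p) && (x != q))
     cnt m (joint_walk E (third p x) (third q x)))%N.
Proof.
rewrite cntS [RHS]big_mkcond; apply: eq_bigr => x _; case: ifP => H.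
  by apply: eq_cnt => v _; rewrite joint_walk_cons andbA H.
by apply: big1 => v _; rewrite joint_walk_cons andbA H.
Qed.

Lemma thirdK p : involutive (third p).
Proof. by move=> x; rewrite /third opprD opprK addKr. Qed.

Lemma thirdC p q : third p q = third q p.
Proof. by rewrite /third addrC. Qed.

Lemma third_id p : third p p = p.
Proof. by case: p => [[|[|[|p]]] ?] //; apply/val_inj. Qed.

Lemma neq_both p q x : p != q -> (x != p) && (x != q) = (x == third p q).
Proof.
move=> pq; have := ruleE x p q.
by rewrite eq_sym pq /= => <-; rewrite /rule /= !inE negb_or pq !andbT.
Qed.

(* Distinct states are swapped by the only admissible letter.  Equal states
   perform a walk on K3, where N_p (m + 1) + N_p m is the total S m over the
   three starting states and S (m + 1) = 2 S m. *)
Lemma rec3_cnt_joint_walk E p q : rec3 (fun m => cnt m (joint_walk E p q)).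
Proof.
move=> m; set N := fun p q m => cnt m (joint_walk E p q).
rewrite -![cnt _ _]/(N _ _ _); have [<-|pq] := eqVneq p q; last first.
  have NS p' q' n : p' != q' -> N p' q' n.+1 = N q' p' n.
    move=> pq'; rewrite /N cnt_joint_walkS.
    rewrite (big_pred1 (third p' q')); last by move=> x; apply: neq_both.
    by rewrite thirdK (thirdC p') thirdK.
  have qp : q != p by rewrite eq_sym.
  (* Two swaps restore the pair, so the count has period 2 in m. *)
  by rewrite !(NS p q) // !(NS q p) // !(NS p q) //; lia.
pose S n := (\sum_x N x x n)%N.
have NS x n : (N x x n.+1 + N x x n = S n)%N.
  rewrite /S (bigD1 x) //= addnC; congr addn.
  (* Sum over the next state instead of the letter read: [third x] is an involution fixing only x
     among the choices that matter, so the letters other than x correspond to the states other than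
     x. *)
  rewrite {1}/N cnt_joint_walkS [RHS](reindex_inj (inv_inj (thirdK x))) /=.
  apply: eq_bigl => y; rewrite andbb.
  by rewrite -[X in _ = (_ != X)]third_id (inj_eq (inv_inj (thirdK x))).
have SS n : S n.+1 = (2 * S n)%N.
  have : (\sum_x (N x x n.+1 + N x x n) = \sum_(x : letter) S n)%N.
    by apply: eq_bigr => x _.
  rewrite big_split /= sum_nat_const card_ord -/(S n) -/(S n.+1); lia.
(* The sums of consecutive counts are S, 2S and 4S. Taken with coefficients 2, -3 and 1 they cancel
   and leave the recurrence. *)
have := NS p m; have := NS p m.+1; have := NS p m.+2; rewrite !SS; lia.
Qed.

(** * From walks to a(m, k) *)

Lemma nleaves_LeftTurnTree m k : (0 < k)%N ->
  nleaves (LeftTurnTree m (k + 1)) = (k + m.+1)%N.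
Proof.
case: k => // k _; rewrite LeftTurnTreeE.
have nl T n : nleaves (iter n (Node^~ Leaf) T) = (nleaves T + n)%N.
  by elim: n => [|n /= ->] /=; lia.
have nr T n : nleaves (iter n (Node Leaf) T) = (nleaves T + n)%N.
  by elim: n => [|n /= ->] /=; lia.
by rewrite nl nr /=; lia.
Qed.

Lemma parsed_by_both u c v : (0 < size u)%N -> (0 < size v)%N ->
  `[< parses (LeftTurnTree (size v) (size u + 1)) (rev u ++ c :: v) >] &&
  `[< parses (RightTurnTree (size u) (size v + 1)) (rev u ++ c :: v) >] =
  walk2 c u v && walk2 c v u.
Proof.
move=> u0 v0; congr andb; apply/asboolP/idP.
- by move/(parses_LeftTurnTree _ _ _ u0).
- by move/(parses_LeftTurnTree _ _ _ u0).
- by move/(parses_RightTurnTree _ _ _ v0).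
- by move/(parses_RightTurnTree _ _ _ v0).
Qed.

(** Freeness of the action needs two distinct letters: the first step of a walk from c cannot read
    c. *)
Lemma walk2_neq_mem c u v : (0 < size v)%N -> walk2 c v u ->
  exists2 x, x \in v & x != c.
Proof.
case: v => // x v _ /walk2P[a [b []]] /walk_cons[d].
by rewrite ruleE => /andP[xc _] _ _; exists x; rewrite ?mem_head.
Qed.

(** Cutting words after k letters confines m to the length of v: the ranges of u and c do not depend
    on m, so a recurrence can be checked term by term. *)
Lemma a_mul6 m k : (0 < m)%N -> (0 < k)%N ->
  (a m k * 6 = \sum_(u : k.-tuple letter) \sum_(c : letter)
     cnt m (fun v => walk2 c (rev u) v && walk2 c v (rev u)))%N.
Proof.
move=> m0 k0; rewrite /a /ParseWords -card_perm_classes; first last.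
- move=> w; rewrite inE => ww.
  have sw : size w = (k + m.+1)%N by rewrite size_tuple nleaves_LeftTurnTree.
  have su : size (rev (take k w)) = k by rewrite size_rev size_takel //; lia.
  move: ww; rewrite -{1 2}(cat_take_drop k w).
  have mem_w x : x \in drop k w -> x \in w by apply: mem_drop.
  have := size_drop k w; case: (drop k w) mem_w => [|c v] mem_w /= sv; first lia.
  have {}sv : size v = m by lia.
  have := parsed_by_both (rev (take k w)) c v; rewrite su sv revK => -> //.
  move=> /andP[_ /walk2_neq_mem]; rewrite sv => /(_ m0)[x xv xc].
  by exists x, c; split=> //; apply: mem_w; rewrite !inE ?eqxx // xv orbT.
- move=> s w; rewrite !inE => /andP[/asboolP p1 /asboolP p2].
  by apply/andP; split; apply/asboolP; apply: parses_map => //; apply: perm_inj.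
rewrite (card_cnt _ (fun w => `[< parses (LeftTurnTree m (k + 1)) w >] &&
                             `[< parses (RightTurnTree k (m + 1)) w >])).
rewrite nleaves_LeftTurnTree // cnt_cat; apply: eq_bigr => u _.
rewrite cntS; apply: eq_bigr => c _; apply: eq_cnt => v /eqP sv.
have su : size (rev u) = k by rewrite size_rev size_tuple.
by have := parsed_by_both (rev u) c v; rewrite su sv revK => ->.
Qed.

(** If the walk along u from c ends at b, then v is read jointly from b and from c; if it fails, all
    counts vanish. *)
Lemma rec3_cnt_walk2 c u :
  rec3 (fun m => cnt m (fun v => walk2 c u v && walk2 c v u)).
Proof.
rewrite /walk2; case wu: (walk c u) => [b|] m /=; last by rewrite /cnt !big1.
have cntE n : cnt n (fun v => isSome (walk b v) && isSome (obind (walk^~ u) (walk c v))) =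
  cnt n (joint_walk (fun d => isSome (walk d u)) b c).
  by apply: eq_cnt => v _; rewrite /joint_walk; case: (walk c v).
by rewrite !cntE; apply: rec3_cnt_joint_walk.
Qed.

Theorem theorem17 (m k : nat) (hm : (1 <= m)%N) (hk : (1 <= k)%N) :
  (a (m + 3) k)%:Z - 2 * (a (m + 2) k)%:Z - (a (m + 1) k)%:Z
    + 2 * (a m k)%:Z = 0.
Proof.
have frec := rec3_sum _ _ (fun u : k.-tuple letter =>
  rec3_sum _ _ (fun c => rec3_cnt_walk2 c (rev u))).
(* The recurrence is known for 6 a(m, k) in [nat]; [lia] cancels the 6 and moves the terms across in
   the integers. *)
have := frec m; rewrite -!a_mul6 // !addnS addn0; lia.
Qed.
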